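(* Let $q\in(0,1)$, $n\ge1$, $b\in\mathbb{R}$ and $k\in\{1,\dots,n\}$. Let $\widetilde{p}_{n,k}(x;b)$ denote the normalized little $q$-Jacobi polynomial with $a=q^{-k}$ (formally ''$(q^{-k+1};q)_n\,p_n(x;q^{-k},b)$''), defined by $$\widetilde{p}_{n,k}(x;b):=\sum_{j=0}^n\frac{(q^{-n};q)_j}{(q;q)_j}\,(bq^{n-k+1};q)_j\,(q^{j-k+1};q)_{n-j}\,(qx)^j .$$ Then $$\widetilde{p}_{n,k}(x;b)=c\,(qx)^k\,p_{n-k}(x;q^k,b),\qquad c=(-1)^k q^{\binom{k}{2}-nk}\,(bq^{n-k+1};q)_k\,(q^{k+1};q)_{n-k}.$$
   Context: For $c\in\mathbb{C}$ and an integer $j\ge0$, $(c;q)_0:=1$ and $(c;q)_j:=\prod_{i=0}^{j-1}(1-cq^i)$; $\binom{1}{2}=0$. The little $q$-Jacobi polynomial of degree $m$ with parameters $a,b$ is $$p_m(x;a,b)=p_m(x;a,b|q):=\sum_{j=0}^m\frac{(q^{-m};q)_j\,(abq^{m+1};q)_j}{(aq;q)_j\,(q;q)_j}\,(qx)^j .$$ For $a=q^{-k}$ with $1\le k\le n$ this formula with $m=n$ may involve division by zero; the normalized polynomial $\widetilde p_{n,k}$ is obtained by multiplying by $(aq;q)_n$ and cancelling, and is denoted $(q^{-k+1};q)_n\,p_n(x;q^{-k},b)$ in the paper. *)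

(* Defs.v *)
From mathcomp Require Import all_boot all_order all_algebra.
Set Implicit Arguments.
Unset Strict Implicit.
Unset Printing Implicit Defensive.
Import GRing.Theory.
Local Open Scope ring_scope.

Section LittleQJacobi.

Variable F : fieldType.
Implicit Types (q a b c : F) (m n k j : nat).

(* (c; q)_j *)
Definition qpoch q c j : F := \prod_(i < j) (1 - c * q ^+ i).

(* p_m(x; a, b | q) as a polynomial in x *)
Definition little_qjacobi q a b m : {poly F} :=
  \sum_(j < m.+1)
    ((qpoch q (q ^- m) j * qpoch q (a * b * q ^+ m.+1) j) /
     (qpoch q (a * q) j * qpoch q q j)) *: (q *: 'X) ^+ j.

(* The polynomial "(q^{-k+1}; q)_n p_n(x; q^{-k}, b)": the factor
   (q^{-k+1}; q)_n / (q^{-k+1}; q)_j is cancelled to (q^{j-k+1}; q)_{n-j}.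
   Exponents involving n - k and j - k are integers, not truncated. *)
Definition little_qjacobi_normalized q b n k : {poly F} :=
  \sum_(j < n.+1)
    (qpoch q (q ^- n) j / qpoch q q j
     * qpoch q (b * q ^ (n%:Z - k%:Z + 1)) j
     * qpoch q (q ^ (j%:Z - k%:Z + 1)) (n - j)) *: (q *: 'X) ^+ j.

End LittleQJacobi.

(* Main.v *)
Require Import Defs.
From mathcomp Require Import all_boot all_order all_algebra.
From mathcomp Require Import reals.
From mathcomp Require Import ring zify.
Set Implicit Arguments.
Unset Strict Implicit.
Unset Printing Implicit Defensive.
Import Order.TTheory GRing.Theory Num.Theory.
Local Open Scope ring_scope.

(** The factor [(q^(j-k+1); q)_(n-j)] of the [j]-th coefficient contains
    [1 - q^0] exactly when [j < k], so the normalized polynomial starts at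
    degree [k] ([qpoch_expz_eq0]).  After the shift [j = k + i], each shifted
    factorial [(c; q)_(k+i)] splits as [(c; q)_k (c q^k; q)_i] ([qpochD]); the
    factors depending on [i] are those of [p_(n-k)(x; q^k, b)], and what
    remains is the constant
    [(q^-n; q)_k (b q^(n-k+1); q)_k (q; q)_(n-k) / (q; q)_k].
    Reversing [(q^-n; q)_k] ([qpoch_expN]) turns it into the announced [c],
    because both [(q; q)_(n-k) (q^(n-k+1); q)_k] and [(q; q)_k (q^(k+1); q)_(n-k)]
    are [(q; q)_n].  Every denominator is a product of powers of [q] and of factors
    [1 - q^l] with [l > 0], so all of this holds over any field in which [q] is
    nonzero and not a root of unity. *)

Section QPochhammer.

Variable F : fieldType.
Implicit Types (q b c : F) (m n k i j : nat).

Lemma qpochD q c m n :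
  qpoch q c (m + n) = qpoch q c m * qpoch q (c * q ^+ m) n.
Proof.
rewrite /qpoch big_split_ord /=; congr (_ * _).
by apply: eq_bigr => i _; rewrite exprD mulrA.
Qed.

Lemma qpoch_neq0 q i j : (forall l, q ^+ l.+1 != 1) ->
  qpoch q (q ^+ i.+1) j != 0.
Proof.
move=> q1; apply/prodf_neq0 => l _.
by rewrite -exprD addSn subr_eq0 eq_sym q1.
Qed.

(** The factor of index [k - 1 - j] is [1 - q^0]. *)
Lemma qpoch_expz_eq0 q n k j : q != 0 -> (j < k <= n)%N ->
  qpoch q (q ^ (j%:Z - k%:Z + 1)) (n - j) = 0.
Proof.
move=> q0 /andP[jk kn]; have lt_i : (k.-1 - j < n - j)%N by lia.
rewrite /qpoch (bigD1 (Ordinal lt_i)) //= exprnP -expfzDr //.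
have -> : j%:Z - k%:Z + 1 + (k.-1 - j)%N%:Z = 0 by lia.
by rewrite expr0z subrr mul0r.
Qed.

(** Since [1 - q^(i-n) = - q^(i-n) (1 - q^(n-i))], and the [1 - q^(n-i)] with
    [i < k] are the factors of [(q^(n-k+1); q)_k] in reverse order.  Hence the
    induction on [k] peels off the last factor on the left and the first one on
    the right. *)
Lemma qpoch_expN q n k : q != 0 -> (k <= n)%N ->
  qpoch q (q ^- n) k =
    (-1) ^+ k * q ^ ('C(k, 2)%:Z - n%:Z * k%:Z) * qpoch q (q ^+ (n - k).+1) k.
Proof.
move=> q0; elim: k => [_ | k IHk kn].
  by rewrite /qpoch !big_ord0 mulr0 subrr expr0z !mulr1.
rewrite -[in LHS]addn1 qpochD IHk ?(ltnW kn) // subnSK //.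
rewrite -[in RHS](add1n k) qpochD expr1 -exprSr add1n.
have -> : 'C(k.+1, 2)%:Z - n%:Z * k.+1%:Z
        = ('C(k, 2)%:Z - n%:Z * k%:Z) + (k%:Z - n%:Z).
  by rewrite binS bin1; lia.
rewrite [q ^ (_ + (k%:Z - n%:Z))]expfzDr // /qpoch !big_ord1 expr0 !mulr1.
have -> : q ^- n * q ^+ k = q ^ (k%:Z - n%:Z).
  by rewrite addrC expfzDr // -exprnN.
have E : q ^ (k%:Z - n%:Z) * q ^+ (n - k) = 1.
  rewrite exprnP -expfzDr //.
  by have -> : k%:Z - n%:Z + (n - k)%N%:Z = 0 by lia.
rewrite [(-1) ^+ k.+1]exprSr.
move: (q ^ (k%:Z - n%:Z)) (q ^+ (n - k)) E => z y E.
have -> : 1 - z = - z * (1 - y) by rewrite mulrBr mulr1 mulNr E opprK addrC.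
by ring.
Qed.

(** The comparison of the coefficients of [(q x)^(k + i)] on the two sides,
    for [n = k + m].  Once the factorials in [k + i] are split and
    [(q^(i+1); q)_(m-i)] is written [(q; q)_m / (q; q)_i], the dependence on [i]
    is the same on both sides, and the two expressions for [(q; q)_(k+m)] match
    the constants. *)
Lemma normalized_coef q b m k i :
    q != 0 -> (forall l, q ^+ l.+1 != 1) -> (i <= m)%N ->
  qpoch q (q ^- (k + m)) (k + i) / qpoch q q (k + i)
    * qpoch q (b * q ^+ m.+1) (k + i) * qpoch q (q ^+ i.+1) (m - i)
  = ((-1) ^+ k * q ^ ('C(k, 2)%:Z - (k + m)%N%:Z * k%:Z)
     * qpoch q (b * q ^+ m.+1) k * qpoch q (q ^+ k.+1) m)
    * ((qpoch q (q ^- m) i * qpoch q (q ^+ k * b * q ^+ m.+1) i)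
       / (qpoch q (q ^+ k * q) i * qpoch q q i)).
Proof.
move=> q0 q1 im.
have split_qq j l : qpoch q q (j + l) = qpoch q q j * qpoch q (q ^+ j.+1) l.
  by rewrite qpochD -exprS.
have qq_neq0 j : qpoch q q j != 0 by rewrite -{2}[q]expr1 qpoch_neq0.
rewrite -exprSr split_qq !qpochD qpoch_expN ?leq_addr // addKn.
have -> : q ^- (k + m) * q ^+ k = q ^- m.
  by rewrite exprD invfM mulrAC mulVf ?mul1r // expf_neq0.
have -> : b * q ^+ m.+1 * q ^+ k = q ^+ k * b * q ^+ m.+1 by ring.
have Em : qpoch q (q ^+ i.+1) (m - i) = qpoch q q m / qpoch q q i.
  by rewrite -{2}(subnKC im) split_qq mulrAC mulfV ?mul1r.
(* two splittings of (q; q)_(k+m) *)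
have Ek : qpoch q (q ^+ m.+1) k
        = qpoch q q k * qpoch q (q ^+ k.+1) m / qpoch q q m.
  by rewrite -split_qq addnC split_qq mulrAC mulfV ?mul1r.
rewrite Em Ek.
have := qq_neq0 k; have := qq_neq0 m; have := qq_neq0 i.
have := qpoch_neq0 k i q1.
move: (qpoch q q k) (qpoch q q m) (qpoch q q i) (qpoch q (q ^+ k.+1) i).
move: (qpoch q (q ^+ k.+1) m) (q ^ _) ((-1) ^+ k).
move=> A Q S x y z t t0 z0 y0 x0; field.
by rewrite t0 z0 y0 x0.
Qed.

Lemma little_qjacobi_normalizedE q b n k :
    q != 0 -> (forall l, q ^+ l.+1 != 1) -> (k <= n)%N ->
  little_qjacobi_normalized q b n k =
    ((-1) ^+ k * q ^ ('C(k, 2)%:Z - n%:Z * k%:Z)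
     * qpoch q (b * q ^ (n%:Z - k%:Z + 1)) k
     * qpoch q (q ^+ k.+1) (n - k))
    *: ((q *: 'X) ^+ k * little_qjacobi q (q ^+ k) b (n - k)).
Proof.
move=> q0 q1 kn; rewrite -(subnKC kn); move: (n - k)%N => m {n kn}.
rewrite addKn.
have Em : q ^ ((k + m)%N%:Z - k%:Z + 1) = q ^+ m.+1.
  by rewrite exprnP; congr (_ ^ _); lia.
rewrite /little_qjacobi_normalized /little_qjacobi Em -addnS big_split_ord /=.
rewrite big1 ?add0r => [|j _]; last first.
  by rewrite qpoch_expz_eq0 ?mulr0 ?scale0r // ltn_ord leq_addr.
rewrite mulr_sumr scaler_sumr; apply: eq_bigr => i _.
have -> : q ^ ((k + i)%N%:Z - k%:Z + 1) = q ^+ i.+1.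
  by rewrite exprnP; congr (_ ^ _); lia.
rewrite subnDl normalized_coef -1?ltnS // exprD.
by rewrite -scalerAr scalerA.
Qed.

End QPochhammer.

Theorem proposition3p5 (R : realType) (q b : R) (n k : nat)
    (hq0 : 0 < q) (hq1 : q < 1) (hn : (1 <= n)%N)
    (hk1 : (1 <= k)%N) (hkn : (k <= n)%N) :
  little_qjacobi_normalized q b n k =
    ((-1) ^+ k * q ^ ('C(k, 2)%:Z - n%:Z * k%:Z)
     * qpoch q (b * q ^ (n%:Z - k%:Z + 1)) k
     * qpoch q (q ^+ k.+1) (n - k))
    *: ((q *: 'X) ^+ k * little_qjacobi q (q ^+ k) b (n - k)).
Proof.
apply: little_qjacobi_normalizedE => // [|l]; first exact: lt0r_neq0.
by rewrite lt_eqF // exprn_ilt1 // ltW.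
Qed.
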